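(* Assume $\mathfrak{d} = \aleph_1$. Then there exist $\aleph_1$ many compact subsets of $\omega^\omega$ whose union is a Van Douwen MAD family.
   Context: $\omega^\omega$ carries the product (Baire space) topology. $\mathfrak{d}$ denotes the dominating number: the least cardinality of a family $D \subseteq \omega^\omega$ such that every $g \in \omega^\omega$ is eventually dominated by some $f \in D$ (i.e. $g(n) \le f(n)$ for all but finitely many $n$). Functions are identified with their graphs as subsets of $\omega \times \omega$. Two functions $f, g \in \omega^\omega$ are almost disjoint (a.d.) if $\{n : f(n) = g(n)\}$ is finite. A family $\mathscr{A} \subseteq \omega^\omega$ is a.d. if its members are pairwise a.d.; an a.d. family $\mathscr{A} \subseteq \omega^\omega$ is MAD in $\omega^\omega$ if for every $f \in \omega^\omega$ there is $h \in \mathscr{A}$ with $|f \cap h| = \aleph_0$. An infinite partial function is a function $p : A \to \omega$ with $A \subseteq \omega$ infinite. An a.d. family $\mathscr{A} \subseteq \omega^\omega$ is Van Douwen if for every infinite partial function $p$ there is $h \in \mathscr{A}$ with $|h \cap p| = \aleph_0$ (equivalently, $\mathscr{A}$ together with the vertical columns $\{n\}\times\omega$ is a maximal almost disjoint family in $[\omega\times\omega]^\omega$). A Van Douwen MAD family is a MAD family in $\omega^\omega$ that is Van Douwen. *)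

(* Defs.v *)
From mathcomp Require Import all_boot.
From mathcomp Require Import boolp classical_sets functions cardinality topology.

Set Implicit Arguments.
Unset Strict Implicit.
Unset Printing Implicit Defensive.

Local Open Scope classical_set_scope.
Local Open Scope card_scope.

(* [prod_topology] is the product topology, here of countably many copies of
   [nat], whose library topology is the discrete one. *)
Definition baire : topologicalType := prod_topology (fun _ : nat => nat).

(* |A| is the least uncountable cardinal. *)
Definition has_card_aleph1 (T : Type) (A : set T) : Prop :=
  ~ countable A /\ forall (U : Type) (B : set U), ~ countable B -> A #<= B.

Definition eventually_dominated (g f : baire) : Prop :=
  exists N : nat, forall n : nat, N <= n -> g n <= f n.

Definition dominating (D : set baire) : Prop :=
  forall g : baire, exists2 f : baire, D f & eventually_dominated g f.

(* |A| is the least cardinality of a dominating family. *)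
Definition has_card_d (T : Type) (A : set T) : Prop :=
  (exists2 D : set baire, dominating D & A #= D) /\
  (forall D : set baire, dominating D -> A #<= D).

(* Stated through a representative [A] of the common cardinality; the
   dominating number is always attained by some set of functions. *)
Definition d_eq_aleph1 : Prop :=
  exists2 A : set baire, has_card_d A & has_card_aleph1 A.

(* Graph of the partial function with domain [A] that agrees with [p] on [A];
   the values of [p] outside [A] are irrelevant. *)
Definition pgraph (A : set nat) (p : nat -> nat) : set (nat * nat) :=
  [set x | A x.1 /\ x.2 = p x.1].

Definition graph (f : baire) : set (nat * nat) := pgraph [set: nat] f.

Definition almost_disjoint (f g : baire) : Prop :=
  finite_set [set n : nat | f n = g n].

Definition ad_family (F : set baire) : Prop :=
  forall f g : baire, F f -> F g -> f <> g -> almost_disjoint f g.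

Definition mad_family (F : set baire) : Prop :=
  ad_family F /\
  forall f : baire, exists2 h : baire, F h &
    (graph f `&` graph h) #= [set: nat].

Definition van_douwen (F : set baire) : Prop :=
  ad_family F /\
  forall (A : set nat) (p : nat -> nat), infinite_set A ->
    exists2 h : baire, F h & (graph h `&` pgraph A p) #= [set: nat].

Definition van_douwen_mad_family (F : set baire) : Prop :=
  mad_family F /\ van_douwen F.

(* Main.v *)
(* An infinite partial function is met by a compact family K iff the tree of its
   finite pieces that lie on a member of K is ill-founded, so being almost
   disjoint from K is witnessed by a rank into a countable ordinal. As d = aleph1,
   aleph1 many bounds on such ranks suffice, and each bound gives a closed set of
   partial functions. At stage d < omega1 a single compact a.d. family meets all
   partial functions q that lie, for every earlier family, in one of the countably
   many closed sets available below d. Its members h are built along a guess of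
   those closed sets: h copies a finite piece of q each time one more condition on
   q is revealed, and otherwise codes its whole history by values too large for
   the earlier families. A branch along which conditions stop being revealed
   copies q only finitely often, which is what makes the family compact. Each q
   almost disjoint from all stages is caught at an ordinal d closed under its
   witnesses, a contradiction. *)

Require Import Defs.
From mathcomp Require Import all_boot.
From mathcomp Require Import boolp classical_sets functions cardinality topology.
From mathcomp Require Import wochoice zify.

Set Implicit Arguments.
Unset Strict Implicit.
Unset Printing Implicit Defensive.

Local Open Scope classical_set_scope.

(** * Infinite recurrence and agreement on initial segments *)

Definition io (P : nat -> Prop) : Prop := forall N, exists2 m, N <= m & P m.

Lemma not_ioP (P : nat -> Prop) :
  ~ io P -> exists N, forall m, N <= m -> ~ P m.
Proof.
move=> nP; apply: contrapT => nE; apply: nP => N; apply: contrapT => nm.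
by apply: nE; exists N => m Nm Pm; apply: nm; exists m.
Qed.

Lemma bounded_not_io (P : nat -> Prop) (N : nat) :
  (forall m, N <= m -> ~ P m) -> ~ io P.
Proof. by move=> nP ioP; have [m /nP] := ioP N. Qed.

Lemma sub_io (P Q : nat -> Prop) : (forall m, P m -> Q m) -> io P -> io Q.
Proof. by move=> PQ ioP N; have [m Nm /PQ] := ioP N; exists m. Qed.

Lemma infinite_setP (P : set nat) : infinite_set P <-> io P.
Proof.
split=> [infP N|ioP finP].
  apply: contrapT => nm; apply: infP.
  apply: (@sub_finite_set _ _ `I_N); last exact: finite_II.
  move=> m Pm /=; rewrite ltnNge; apply/negP => Nm; apply: nm.
  by exists m.
have [s Ps] := (finite_seqP P).1 finP.
have [m + Pm] := ioP (\max_(i <- s) i).+1.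
have : m \in s by move: Pm; rewrite Ps.
by move=> /(@leq_bigmax_seq _ _ xpredT (fun i => i))/(_ isT) /= ? ?; lia.
Qed.

Lemma injective_unbounded (f : nat -> nat) :
  injective f -> forall N, exists k, N <= f k.
Proof.
move=> injf N; apply: contrapT => nE.
have lt k : f k < N by rewrite ltnNge; apply/negP => ?; apply: nE; exists k.
have /leq_card : injective (fun k : 'I_N.+1 => Ordinal (lt k)).
  by move=> i j [] /injf /val_inj.
by rewrite !card_ord ltnn.
Qed.

Definition agree (n : nat) (f g : nat -> nat) : Prop :=
  forall i, i < n -> f i = g i.

Lemma agreeW (m n : nat) (f g : nat -> nat) :
  m <= n -> agree n f g -> agree m f g.
Proof. by move=> mn fg i im; apply: fg; exact: leq_trans mn. Qed.

Lemma agree_mkseq (n : nat) (f g : nat -> nat) :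
  agree n f g <-> mkseq f n = mkseq g n.
Proof.
split=> [fg|fg i im].
  by apply/eq_in_map => i; rewrite mem_iota => /andP[_]; exact: fg.
by rewrite -(nth_mkseq 0 f im) fg nth_mkseq.
Qed.

(** * Bounded closed sets of functions and compactness *)

Definition approx_closed (P : set (nat -> nat)) : Prop :=
  forall f, (forall n, exists2 h, P h & agree n f h) -> P f.

Definition bounded_closed (P : set (nat -> nat)) : Prop :=
  (exists g : nat -> nat, forall h, P h -> forall n, h n <= g n) /\
  approx_closed P.

(** König's lemma as sequential compactness: as [g] leaves finitely many values, a prefix shared by
    infinitely many [s k] has a one-step extension of the same kind. *)
Lemma koenig (P : set (nat -> nat)) (s : nat -> nat -> nat) :
  bounded_closed P -> (forall n, P (s n)) ->
  exists2 z, P z & forall n, io (fun k => agree n z (s k)).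
Proof.
move=> [[g Pg] Pcl] Ps.
pose Inf (l : seq nat) := io (fun k => mkseq (s k) (size l) = l).
have step l : exists v, Inf l -> Inf (rcons l v).
  apply: contrapT => nE.
  have nI v : exists N, Inf l /\ forall k, N <= k ->
      mkseq (s k) (size l).+1 <> rcons l v.
    apply: contrapT => nN; apply: nE; exists v => Il N.
    apply: contrapT => nk; apply: nN; exists N; split=> // k Nk E.
    by apply: nk; exists k => //; rewrite size_rcons.
  have [N HN] := choice nI.
  have [Il _] := HN 0.
  (* This [k] is past the threshold of every value that [g] allows, so the value of [s k]
     contradicts its own threshold. *)
  have [k Nk kl] := Il (\max_(v < (g (size l)).+1) N v).
  have lt : s k (size l) < (g (size l)).+1 by rewrite ltnS; exact: Pg.
  have := (HN (s k (size l))).2 k; apply.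
    apply: leq_trans Nk.
    exact: (@leq_bigmax _ (fun v : 'I_ _ => N v) (Ordinal lt)).
  by rewrite mkseqS kl.
have [F HF] := choice step.
pose L k := iter k (fun l => rcons l (F l)) [::].
pose z k := F (L k).
have Lz k : mkseq z k = L k by elim: k => // k IH; rewrite mkseqS IH.
have IL k : Inf (L k).
  by elim: k => [N|k IH] /=; [exists N | exact: HF].
have zs n : io (fun k => agree n z (s k)).
  apply: sub_io (IL n) => k; rewrite -Lz size_mkseq => E.
  exact/agree_mkseq.
exists z => //; apply: Pcl => n; have [k _ zk] := zs n 0.
by exists (s k).
Qed.

(** Continuous images of compact sets are compact: both the bound and the limit points come from
    [koenig] applied to a sequence of preimages. *)
Lemma bounded_closed_image (P : set (nat -> nat))
    (H : (nat -> nat) -> nat -> nat) :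
  bounded_closed P ->
  (forall m, exists n, forall z z', agree n z z' -> H z m = H z' m) ->
  bounded_closed (H @` P).
Proof.
move=> Pbc cont; have {cont}[M HM] := choice cont; split; last first.
  move=> f Hf.
  have {}Hf n : exists z, P z /\ agree n f (H z).
    by have [_ [z Pz <-] fz] := Hf n; exists z.
  have [s Hs] := choice Hf.
  have [z Pz zs] := koenig Pbc (fun n => (Hs n).1).
  exists z => //; apply/funext => m.
  have [k mk zk] := zs (M m) m.+1.
  by rewrite (HM _ _ _ zk) -(Hs k).2.
suff /choice[g Hg] : forall m, exists v, forall z, P z -> H z m <= v.
  by exists g => _ [z Pz <-] m; exact: Hg.
move=> m; apply: contrapT => nE.
have /choice[s Hs] : forall v, exists z, P z /\ v < H z m.
  move=> v; apply: contrapT => nz; apply: nE; exists v => z Pz.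
  by rewrite leqNgt; apply/negP => lt; apply: nz; exists z.
have [z Pz zs] := koenig Pbc (fun n => (Hs n).1).
have [k zk /(HM m) E] := zs (M m) (H z m).
by have := (Hs k).2; rewrite -E ltnNge zk.
Qed.

(** [K] is closed inside a product of finite sets, which is compact by Tychonoff. *)
Lemma bounded_closed_compact (K : set baire) : bounded_closed K -> compact K.
Proof.
move=> [[g Kg] Kcl].
have box : compact [set f : baire | forall i, [set k : nat | k <= g i] (f i)].
  apply: (@tychonoff nat (fun _ => nat) (fun i => [set k | k <= g i])) => i.
  apply: finite_compact.
  by apply: (@sub_finite_set _ _ `I_(g i).+1); last exact: finite_II.
apply: subclosed_compact box _; last by move=> h Kh i /=; exact: Kg.
move=> f clf; apply: Kcl => n.
have nb : nbhs f [set h : baire | agree n f h].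
  elim: n => [|n IH]; first by apply: filterS filterT => h _ i.
  have nbn : nbhs f [set h : baire | h n = f n].
    apply: (@proj_continuous nat (fun _ => nat) n f [set v | v = f n]).
    exact: discrete_set1.
  apply: filterS (filterI IH nbn) => h [fh hn] i.
  by rewrite ltnS leq_eqVlt => /predU1P[->//|]; exact: fh.
by have [h [Kh fh]] := clf _ nb; exists h.
Qed.

(** * A single stage: coding guesses into a compact family *)

(* Here and below [q] codes a partial function: [q m = v.+1] stands for the value
   [v] at [m], and [q m = 0] for [m] outside of the domain. *)
Definition meets (q h : nat -> nat) : Prop := io (fun m => q m = (h m).+1).

Definition eventually_different (f h : nat -> nat) : Prop :=
  ~ io (fun m => f m = h m).

(** The block starting at [a] contains all points from [a] to [g a], so a domain that meets these
    intervals meets every late block. *)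
Definition block_start (g : nat -> nat) (k : nat) : nat :=
  iter k (fun a => (maxn a (g a)).+1) 0.

Lemma block_start_mono (g : nat -> nat) :
  {homo block_start g : k l / k <= l}.
Proof.
apply: homo_leq => // [k l m|k]; first exact: leq_trans.
by rewrite /block_start /=; lia.
Qed.

Lemma leq_block_start (g : nat -> nat) (k : nat) : k <= block_start g k.
Proof. by elim: k => // k; rewrite /block_start /=; lia. Qed.

Lemma block_inj (g : nat -> nat) (k l m : nat) :
  block_start g k <= m < block_start g k.+1 ->
  block_start g l <= m < block_start g l.+1 -> k = l.
Proof.
move=> /andP[km mk] /andP[lm ml].
have [kl|lk|//] := ltngtP k l.
  by have := block_start_mono g kl; lia.
by have := block_start_mono g lk; lia.
Qed.

(* [z] packs a partial function [q m = (z m)./2] with the times [l], [z l] odd, at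
   which a condition on [q] is revealed. Each such time opens the single block
   whose index codes the history [mkseq z l.+1]: distinct histories open
   almost disjoint sets of blocks, whatever the domain of [q] is. *)
Definition shows_block (g z : nat -> nat) (k m : nat) : Prop :=
  exists l, [/\ odd (z l), k = pickle (mkseq z l.+1),
                block_start g k <= m < block_start g k.+1 & (z m)./2 <> 0].

(** Predecessor undoes the coding of values. Values that are not copied are at least [G m], to be
    chosen above all copied ones. *)
Definition branch (g G z : nat -> nat) (m : nat) : nat :=
  if `[< exists k, shows_block g z k m >] then (z m)./2.-1
  else G m + pickle (mkseq z m).

(** A block containing [m] has index at most [m], and the index determines the length of the history
    that opens it. *)
Lemma branch_cont (g G : nat -> nat) (m : nat) :
  exists n, forall z z', agree n z z' -> branch g G z m = branch g G z' m.
Proof.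
pose M := \max_(k < m.+1) size (odflt [::] (unpickle k) : seq nat).
exists (M + m.+1) => z z' zz'.
have zm : z m = z' m by apply: zz'; lia.
have sub u v : agree (M + m.+1) u v ->
    (exists k, shows_block g u k m) -> exists k, shows_block g v k m.
  move=> uv [k [l [ul kE km um]]]; exists k, l.
  have lM : l < M.
    have lt : k < m.+1 by have := leq_block_start g k; lia.
    have E : size (odflt [::] (unpickle k) : seq nat) = l.+1.
      by rewrite kE pickleK /= size_map size_iota.
    rewrite -E.
    exact: (@leq_bigmax _ (fun k : 'I_m.+1 =>
      size (odflt [::] (unpickle k) : seq nat)) (Ordinal lt)).
  rewrite -uv; last by lia.
  rewrite -(uv m); last by lia.
  split=> //; rewrite kE; congr pickle; apply/agree_mkseq.
  by apply: agreeW uv; lia.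
rewrite /branch zm.
have -> : (exists k, shows_block g z k m) = (exists k, shows_block g z' k m).
  by apply/propext; split; apply: sub => // i /zz'.
have -> // : mkseq z m = mkseq z' m.
by apply/agree_mkseq; apply: agreeW zz'; lia.
Qed.

(** Two coded values differ once the histories do, a copied value is below every coded one, and two
    copied values at [m] force a common block, hence a common history. *)
Lemma branch_eventually_different (g G z z' : nat -> nat) :
  (forall m, (z m)./2 <= G m) -> (forall m, (z' m)./2 <= G m) ->
  branch g G z <> branch g G z' ->
  eventually_different (branch g G z) (branch g G z').
Proof.
move=> zG z'G zz'.
have [l0 zl0] : exists l, z l <> z' l.
  by apply: contrapT => nE; apply: zz'; congr branch; apply/funext => l;
     apply: contrapT => ?; apply: nE; exists l.
have diff l : l0 < l -> mkseq z l <> mkseq z' l.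
  by move=> l0l /agree_mkseq /(_ l0 l0l).
have pdiff l : l0 < l -> pickle (mkseq z l) <> pickle (mkseq z' l).
  by move=> l0l /(pcan_inj pickleK); exact: diff.
(* Blocks opened by histories of length at most [l0] end by [M]; longer histories of [z] and [z']
   differ. *)
pose M := \max_(l < l0) block_start g (pickle (mkseq z l.+1)).+1.
apply: (@bounded_not_io _ (M + l0.+1)) => m Mm.
have l0m : l0 < m by lia.
rewrite /branch.
case: asboolP => [[k [l [zl kE km zm]]]|_].
  case: asboolP => [[k' [l' [zl' kE' km' zm']]]|_]; last first.
    by have := zG m; lia.
  move=> _; have kk' := block_inj km km'.
  move: kE' km; rewrite -kk' kE => /(pcan_inj pickleK) E.
  have ll' : l = l' by have := congr1 size E; rewrite !size_mkseq => -[].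
  move: E; rewrite -ll' => E.
  have [/diff/(_ E)//|ll0] := ltnP l0 l.+1.
  move=> /andP[_].
  have := @leq_bigmax _
    (fun l : 'I_l0 => block_start g (pickle (mkseq z l.+1)).+1) (Ordinal ll0).
  by rewrite -/M /= => ? ?; lia.
case: asboolP => [[k' [l' [zl' kE' km' zm']]]|_].
  by have := z'G m; lia.
by have := pdiff m l0m; lia.
Qed.

(* [Y n] is the closed set of partial functions satisfying condition [n], which
   guarantees almost disjointness from [L i] for all [i < lev n]. *)
Record stage_family (g : nat -> nat) (L Y : nat -> set (nat -> nat))
    (lev : nat -> nat) (K : set (nat -> nat)) : Prop := StageFamily {
  stage_bounded_closed : bounded_closed K;
  stage_neq0 : K !=set0;
  stage_ad : forall f h, K f -> K h -> f <> h -> eventually_different f h;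
  stage_ad_prev : forall i f h, K f -> L i h -> eventually_different f h;
  stage_meets : forall q, (forall m, q m <= g m) ->
    (exists c, forall k, c <= k -> exists2 m, k <= m <= g k & q m <> 0) ->
    (forall k, exists2 n, lev n = k & Y n q) ->
    exists2 h, K h & meets q h }.

(** The family is the image under [branch] of a compact set of packed functions [z], where time [n]
    can reveal only condition [Y n]. *)
Lemma stage_family_exists (g : nat -> nat) (L Y : nat -> set (nat -> nat))
    (lev : nat -> nat) :
  (forall i, bounded_closed (L i)) -> (forall n, approx_closed (Y n)) ->
  (forall n i q h, Y n q -> i < lev n -> L i h -> ~ meets q h) ->
  exists K, stage_family g L Y lev K.
Proof.
move=> Lbc Ycl YL.
have [b Lb] := choice (fun i => (Lbc i).1).
(* The diagonal sum puts [G m] above all members of [L i] at [m] as soon as [i <= m]. *)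
pose G m := (g m).+1 + \sum_(i < m.+1) b i m.
have GL i h m : L i h -> i <= m -> h m < G m.
  move=> Lh im; rewrite /G addSn ltnS.
  have lt : i < m.+1 by [].
  apply: leq_trans (Lb _ _ Lh m) _.
  apply: leq_trans (leq_addl _ _).
  by rewrite (bigD1 (Ordinal lt)) //= leq_addr.
(* Distinct revealed conditions have distinct levels, so that infinitely many of
   them guarantee almost disjointness from every [L i]. *)
pose P z := [/\ forall m, (z m)./2 <= g m,
  forall n, odd (z n) -> Y n (fun m => (z m)./2) &
  forall n n', odd (z n) -> odd (z n') -> lev n = lev n' -> n = n'].
have PG z : P z -> forall m, (z m)./2 <= G m.
  by move=> [zg _ _] m; rewrite /G; have := zg m; lia.
have Pbc : bounded_closed P.
  split.
    exists (fun n => (g n).*2.+1) => z [zg _ _] n.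
    by have := zg n; have := odd_double_half (z n); lia.
  move=> z zP; split=> [m|n zn|n n' zn zn'].
  - by have [z' [z'g _ _] zz'] := zP m.+1; rewrite zz'.
  - apply: Ycl => N; have [z' [_ z'Y _] zz'] := zP (N + n.+1).
    exists (fun m => (z' m)./2); last by move=> i iN; rewrite zz' //; lia.
    by apply: z'Y; rewrite -zz' //; lia.
  - have [z' [_ _ z'lev] zz'] := zP (n + n').+1.
    by apply: z'lev; rewrite -zz' //; lia.
exists (branch g G @` P); split.
- exact: bounded_closed_image Pbc (branch_cont g G).
- by exists (branch g G (fun=> 0)), (fun=> 0).
- move=> _ _ [z Pz <-] [z' Pz' <-].
  by apply: branch_eventually_different; exact: PG.
- move=> i _ h [z Pz <-] Lh.
  have [zg zY zlev] := Pz.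
  (* Either a revealed condition of level above [i] keeps the copied function from meeting [h], or
     finitely many conditions are revealed and copying stops. *)
  have [N HN] : exists N, forall m, N <= m ->
      (exists k, shows_block g z k m) -> (z m)./2 <> (h m).+1.
    have [[n [zn levn]]|nE] := pselect (exists n, odd (z n) /\ i < lev n).
      have [N HN] := not_ioP (YL n i _ h (zY n zn) levn Lh).
      by exists N => m Nm _; exact: HN.
    have levi n : odd (z n) -> lev n < i.+1.
      by move=> zn; rewrite ltnNge; apply/negP => ?; apply: nE; exists n.
    have [l0 zl0] : exists l0, forall l, odd (z l) -> l < l0.
      have /not_ioP[l0 Hl0] : ~ io (fun l => odd (z l)).
        move=> /infinite_setP; apply.
        have : finite_set (lev @` [set l | odd (z l)]).
          apply: (@sub_finite_set _ _ `I_i.+1); last exact: finite_II.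
          by move=> _ [n zn <-]; exact: levi.
        have inj : {in [set l | odd (z l)] &, injective lev}.
          by move=> n n'; rewrite !inE; exact: zlev.
        by rewrite (eq_finite_set (inj_card_eq inj)).
      exists l0 => l zl; rewrite ltnNge; apply/negP => /Hl0.
      by rewrite zl.
    pose M := \max_(l < l0) block_start g (pickle (mkseq z l.+1)).+1.
    exists M => m Mm [k [l [/zl0 ll0 kE /andP[_ mk] _]]].
    have := @leq_bigmax _
      (fun l : 'I_l0 => block_start g (pickle (mkseq z l.+1)).+1) (Ordinal ll0).
    by move: mk; rewrite -/M /= kE; lia.
  apply: (@bounded_not_io _ (N + i)) => m Nm.
  rewrite /branch; case: asboolP => [hit|_].
    have : (z m)./2 <> 0 by have [k [l []]] := hit.
    by have := HN m (leq_trans (leq_addr _ _) Nm) hit; lia.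
  by have := GL i h m Lh; lia.
- move=> q qg [c qc] qY.
  have /choice[nu nuP] : forall k, exists n, lev n = k /\ Y n q.
    by move=> k; have [n] := qY k; exists n.
  (* The parity bit reveals, for each level [k], the one condition [nu k] chosen among those true of
     [q]. *)
  pose z m := (m == nu (lev m)) + (q m).*2.
  have zq m : (z m)./2 = q m by rewrite half_bit_double.
  have zodd m : odd (z m) = (m == nu (lev m)).
    by rewrite oddD odd_double addbF oddb.
  have nu_odd k : odd (z (nu k)) by rewrite zodd (nuP k).1.
  exists (branch g G z).
    exists z => //; split=> [m|n|n n'].
    - by rewrite zq.
    - rewrite zodd => /eqP ->.
      by rewrite (funext zq); exact: (nuP _).2.
    - by rewrite !zodd => /eqP -> /eqP -> ; rewrite !(nuP _).1 => ->.
  have inj : injective (fun k => pickle (mkseq z (nu k).+1)).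
    move=> k k' /(pcan_inj pickleK) /(congr1 size).
    by rewrite !size_mkseq => -[E]; rewrite -(nuP k).1 E (nuP k').1.
  (* Some opened block [j] starts beyond both [N] and [c], hence contains a point of the domain of
     [q]. *)
  move=> N; have [k] := injective_unbounded inj (N + c).
  set j := pickle _ => jN.
  have aj := leq_block_start g j.
  have [|m /andP[am mg] qm] := qc (block_start g j); first by lia.
  exists m; first by lia.
  rewrite /branch asboolT; first by rewrite zq; lia.
  exists j, (nu k); split=> //; last by rewrite zq.
  by rewrite am /= /block_start /= ltnS leq_max mg orbT.
Qed.

(** * Orders of type omega1 and well-founded recursion *)

Record omega1_order (I : Type) (lt : I -> I -> Prop) : Prop := Omega1Order {
  omega1_wf : well_founded lt;
  omega1_total : forall a b, [\/ a = b, lt a b | lt b a];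
  omega1_trans : forall a b c, lt a b -> lt b c -> lt a c;
  omega1_countable : forall b, countable [set a | lt a b];
  omega1_uncountable : ~ countable [set: I] }.

(** Regularity of omega1: an unbounded countable [S] would make [I] a countable union of countable
    segments. *)
Lemma omega1_bound (I : Type) (lt : I -> I -> Prop) (S : set I) :
  omega1_order lt -> countable S -> exists u, forall a, S a -> lt a u.
Proof.
move=> lto cS.
have cB : countable (\bigcup_(a in S) ([set b | lt b a] `|` [set a])).
  apply: bigcup_countable => // a _.
  rewrite -bigcup2E; apply: bigcup_countable => // -[|[|n]] _ //=.
  exact: (omega1_countable lto).
apply: contrapT => nE; apply: (omega1_uncountable lto).
rewrite (_ : setT = \bigcup_(a in S) ([set b | lt b a] `|` [set a]))//.
apply/seteqP; split=> // u _; apply: contrapT => nu; apply: nE; exists u.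
move=> a Sa; have [ua|//|ua] := omega1_total lto a u; case: nu.
  by exists a => //; right.
by exists a => //; left.
Qed.

Lemma omega1_bound_fun (I J : Type) (lt : I -> I -> Prop) (S : set J)
    (f : J -> I) :
  omega1_order lt -> countable S -> exists u, forall a, S a -> lt (f a) u.
Proof.
move=> lto cS; have [|u Hu] := @omega1_bound I lt (f @` S) lto.
  exact: sub_countable (card_image_le _ _) cS.
by exists u => a Sa; apply: Hu; exists a.
Qed.

Lemma wf_minimal (I : Type) (lt : I -> I -> Prop) (P : set I) :
  well_founded lt -> P !=set0 ->
  exists2 m, P m & forall a, lt a m -> ~ P a.
Proof.
move=> ltwf [u]; apply: contraPP => nE; elim/(well_founded_ind ltwf): u.
by move=> u IH Pu; apply: nE; exists u.
Qed.

Lemma omega1_closure (I : Type) (lt : I -> I -> Prop) (phi : I -> I) (u0 : I) :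
  omega1_order lt ->
  exists2 d, lt u0 d & forall a, lt a d -> lt (phi a) d.
Proof.
move=> lto.
have /choice[s Hs] : forall u, exists v,
    lt u v /\ forall a, lt a u \/ a = u -> lt (phi a) v.
  move=> u.
  have [v Hv] := omega1_bound_fun phi lto (omega1_countable lto u).
  have [w Hw] := omega1_bound lto
    (finite_set_countable (finite_set3 u v (phi u))).
  exists w; split; first by apply: Hw => /=; left; left.
  move=> a [au|->]; last by apply: Hw; right.
  by apply: (omega1_trans lto (Hv _ au)); apply: Hw; left; right.
pose t n := iter n s u0.
(* [d] is the supremum of the iterates, so each [a] below [d] is at most some [t n], and [t n.+1]
   bounds [phi a]. *)
have [|d dt dmin] :=
  @wf_minimal I lt [set d | forall n, lt (t n) d] (omega1_wf lto).
  have [u Hu] := omega1_bound_fun t lto (countableP [set: nat]).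
  by exists u => n; exact: Hu.
exists d => [|a ad]; first exact: (dt 0).
have [n nta] : exists n, ~ lt (t n) a.
  by apply: contrapT => nE; apply: (dmin a ad) => n; apply: contrapT => ?;
     apply: nE; exists n.
have an : lt a (t n) \/ a = t n.
  by have [->|//|] := omega1_total lto a (t n); [right|left|].
exact: (omega1_trans lto ((Hs (t n)).2 a an) (dt n.+1)).
Qed.

(** Masking by the default [d] lets the recursion equation speak of total functions. *)
Lemma wf_recursion (A V : Type) (R : A -> A -> Prop) (d : V)
    (F : A -> (A -> V) -> V) : well_founded R ->
  exists f, forall a, f a = F a (fun b => if `[< R b a >] then f b else d).
Proof.
move=> wfR.
pose G (a : A) (rec : forall b, R b a -> V) :=
  F a (fun b => if pselect (R b a) is left Rba then rec b Rba else d).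
exists (Fix wfR (fun _ => V) G) => a; rewrite Fix_eq => [|b f g fg].
  congr (F a _); apply/funext => b.
  by case: pselect => Rba; [rewrite asboolT | rewrite asboolF].
by congr (F b _); apply/funext => c; case: pselect.
Qed.

(** * Ranks witnessing almost disjointness from a compact family *)

Definition hit_tree (K : set (nat -> nat)) (q : nat -> nat) (e : seq nat) :
    Prop :=
  uniq e /\ exists2 h, K h & forall m, m \in e -> q m = (h m).+1.

(** Along an infinite branch the witnesses in [K] vary, but their limit given by [koenig] agrees
    with [q] on the whole branch. *)
Lemma hit_tree_wf (K : set (nat -> nat)) (q : nat -> nat) :
  bounded_closed K -> (forall h, K h -> ~ meets q h) ->
  well_founded (fun e' e => hit_tree K q e' /\ exists m, e' = m :: e).
Proof.
move=> Kbc qad e0; set R := (R in Acc R).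
apply: contrapT => nacc.
have /choice[f Hf] : forall e, exists e', ~ Acc R e -> R e' e /\ ~ Acc R e'.
  move=> e; apply: contrapT => nE; have ne : ~ Acc R e.
    by move=> ae; apply: nE; exists e.
  apply: ne; constructor=> e' Re'; apply: contrapT => ae'.
  by apply: nE; exists e'.
pose E k := iter k f e0.
have nE k : ~ Acc R (E k) by elim: k => //= k /Hf[].
have RE k : R (E k.+1) (E k) := (Hf _ (nE k)).1.
have sE k : k <= size (E k).
  elim: k => // k IH; have [_ [m ->]] := RE k.
  by rewrite /= ltnS.
have subE k l : k <= l -> {subset E k <= E l}.
  elim: l => [|l IH]; first by rewrite leqn0 => /eqP ->.
  rewrite leq_eqVlt => /predU1P[->//|]; rewrite ltnS => /IH kl m /kl ml.
  by have [_ [n ->]] := RE l; rewrite inE ml orbT.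
have /choice[h Hh] : forall k, exists h,
    K h /\ forall m, m \in E k.+1 -> q m = (h m).+1.
  by move=> k; have [[_ [h Kh qh]] _] := RE k; exists h.
have [z Kz zh] := koenig Kbc (fun k => (Hh k).1).
apply: (qad z Kz) => N.
have [m mE Nm] : exists2 m, m \in E N.+1 & N <= m.
  apply: contrapT => nm.
  have [[uE _] _] := RE N.
  have : {subset E N.+1 <= iota 0 N}.
    move=> m mE; rewrite mem_iota ltnNge; apply/negP => Nm.
    by apply: nm; exists m.
  move=> /(uniq_leq_size uE); rewrite size_iota leqNgt => /negP; apply.
  exact: sE.
exists m => //; have [k Nk zk] := zh m.+1 N.
by rewrite (zk m)//; apply: (Hh k).2; exact: subE mE.
Qed.

(** A node has countably many children, so their ranks have a strict bound in omega1. *)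
Lemma hit_rank_exists (I : Type) (lt : I -> I -> Prop)
    (K : set (nat -> nat)) (q : nat -> nat) :
  omega1_order lt -> bounded_closed K -> (forall h, K h -> ~ meets q h) ->
  exists r : seq nat -> I, forall m e, hit_tree K q (m :: e) ->
    lt (r (m :: e)) (r e).
Proof.
move=> lto Kbc qad.
have [i0 _] : [set: I] !=set0.
  apply/set0P/eqP => I0; apply: (omega1_uncountable lto).
  by rewrite I0; exact: countable0.
have /choice[sup Hsup] : forall f : nat -> I, exists u, forall n, lt (f n) u.
  move=> f; have [u Hu] := omega1_bound_fun f lto (countableP [set: nat]).
  by exists u => n; exact: Hu.
have [r Hr] := wf_recursion i0 (fun e rec => sup (fun m => rec (m :: e)))
  (hit_tree_wf Kbc qad).
exists r => m e me; rewrite (Hr e).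
set rec := (F in lt _ (sup F)).
have -> : r (m :: e) = rec m by rewrite /rec asboolT//; split=> //; exists m.
exact: Hsup.
Qed.

Definition ranked (K : set (nat -> nat)) (W : nat -> nat -> Prop)
    (b : nat -> nat) : set (nat -> nat) :=
  [set q | exists2 rho : nat -> nat, (forall n, rho n <= b n) &
    forall m e, hit_tree K q (m :: e) ->
      W (rho (pickle (m :: e))) (rho (pickle e))].

(** The bound [b] makes the space of rank functions compact, so those of the approximations to [q]
    have a limit; each rank inequality involves finitely many values. *)
Lemma ranked_closed (K : set (nat -> nat)) (W : nat -> nat -> Prop)
    (b : nat -> nat) : approx_closed (ranked K W b).
Proof.
move=> q Hq.
have /choice[rho Hrho] : forall n, exists rho : nat -> nat,
    (forall k, rho k <= b k) /\ forall q', agree n q q' ->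
    forall m e, hit_tree K q (m :: e) -> (forall i, i \in m :: e -> i < n) ->
      W (rho (pickle (m :: e))) (rho (pickle e)).
  move=> n; have [q' [rho rb rW] qq'] := Hq n.
  exists rho; split=> // _ _ m e [ume [h Kh qh]] men.
  apply: rW; split=> //; exists h => // i ime.
  by rewrite -qq'; [exact: qh | exact: men].
have box : bounded_closed [set r : nat -> nat | forall k, r k <= b k].
  split; first by exists b.
  by move=> f Hf k; have [r rb fr] := Hf k.+1; rewrite fr.
have [r rb rrho] := koenig box (fun n => (Hrho n).1).
exists r => // m e me.
have [n nm rn] := rrho (pickle (m :: e) + pickle e).+1
  (\max_(i <- m :: e) i).+1.
rewrite !rn; [|by lia..].
apply: ((Hrho n).2 q) => // i ime.
by apply: leq_trans nm; rewrite ltnS; exact: (@leq_bigmax_seq _ _ xpredT id).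
Qed.

Lemma ranked_sub (K : set (nat -> nat)) (W : nat -> nat -> Prop)
    (b q q' : nat -> nat) : (forall m, q' m <> 0 -> q' m = q m) ->
  ranked K W b q -> ranked K W b q'.
Proof.
move=> q'q [rho rb rW]; exists rho => // m e [ume [h Kh qh]].
by apply: rW; split=> //; exists h => // i ime; rewrite -q'q qh.
Qed.

(** Infinitely many hits on one [h] would give a descending sequence of ranks in [W]. *)
Lemma ranked_not_meets (K : set (nat -> nat)) (W : nat -> nat -> Prop)
    (b q h : nat -> nat) :
  well_founded W -> ranked K W b q -> K h -> ~ meets q h.
Proof.
move=> wfW [rho _ rW] Kh qh.
suff H v e : rho (pickle e) = v -> uniq e ->
    (forall m, m \in e -> q m = (h m).+1) -> False.
  exact: (H _ [::]).
elim/(well_founded_ind wfW): v e => v IH e ev ue eh.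
have [m em qm] := qh (\max_(i <- e) i).+1.
have me : uniq (m :: e).
  rewrite /= ue andbT; apply/negP => me; move: em; apply/negP.
  by rewrite -leqNgt; exact: (@leq_bigmax_seq _ _ xpredT id).
have meh i : i \in m :: e -> q i = (h i).+1.
  by rewrite inE => /predU1P[->//|]; exact: eh.
apply: (IH (rho (pickle (m :: e))) _ (m :: e)) => //.
by rewrite -ev; apply: rW; split=> //; exists h.
Qed.

(** * An order of type omega1 on any set of cardinality aleph1 *)

Lemma strict_well_order_exists (T : eqType) : exists lt : T -> T -> Prop,
  [/\ well_founded lt, forall a b, [\/ a = b, lt a b | lt b a] &
      forall a b c, lt a b -> lt b c -> lt a c].
Proof.
have [R woR] := well_ordering_principle T.
have least (P : set T) : P !=set0 -> exists2 m, P m & forall x, P x -> R m x.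
  move=> [x Px]; have [|m [[mP mR] _]] := woR [pred x | `[< P x >]].
    by exists x; exact/asboolP.
  exists m => [|y Py]; first exact/asboolP.
  by apply: mR; exact/asboolP.
have anti x y : R x y -> R y x -> x = y.
  move=> xy yx; have [|m [_ mU]] := woR (pred2 x y).
    by exists x; rewrite inE eqxx.
  have Rxx : R x x.
    by have [|_ -> Rx] := least [set x]; [exists x | exact: Rx].
  have Ryy : R y y.
    by have [|_ -> Ry] := least [set y]; [exists y | exact: Ry].
  by rewrite -(mU x) ?(mU y)//; split; rewrite ?inE ?eqxx ?orbT// => z;
    rewrite inE => /orP[] /eqP ->.
exists (fun a b => R a b /\ a <> b); split.
- move=> u; apply: contrapT => nu.
  have [|m nm mR] := least [set x | ~ Acc (fun a b => R a b /\ a <> b) x].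
    by exists u.
  apply: nm; constructor => x [xm nxm]; apply: contrapT => nx.
  exact: nxm (anti _ _ xm (mR x nx)).
- move=> a b; have [|m] := least [set a; b]; first by exists a; left.
  have [->|ab] := pselect (a = b); first by constructor 1.
  case=> -> mR; [constructor 2 | constructor 3].
    by split=> //; apply: mR; right.
  by split; [apply: mR; left | exact/nesym].
- move=> a b c [ab nab] [bc nbc].
  have ac : R a c.
    have [|m] := least [set x | [\/ x = a, x = b | x = c]].
      by exists a; constructor 1.
    case=> -> mR; first by apply: mR; constructor 3.
      by case: nab; apply: anti => //; apply: mR; constructor 1.
    by case: nbc; apply: anti => //; apply: mR; constructor 2.
  by split=> // E; apply: nab; apply: anti => //; rewrite E.
Qed.

Lemma omega1_order_exists (T : eqType) :
  has_card_aleph1 [set: T] -> exists lt : T -> T -> Prop, omega1_order lt.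
Proof.
move=> [Tunc Tmin].
have [lt [ltwf lttot lttr]] := strict_well_order_exists T.
pose U := [set x | countable [set y | lt y x]].
(* The predecessors of the least point outside [U] lie in [U]; were [U] countable, that point would
   belong to it. *)
have Uunc : ~ countable U.
  move=> cU.
  have [|d nd dmin] := @wf_minimal _ lt (~` U) ltwf.
    apply/set0P/eqP => U0; apply: Tunc.
    by rewrite -setC0 -U0 setCK.
  apply: nd; apply: sub_countable cU; apply: subset_card_le => x xd.
  by apply: contrapT; exact: dmin.
have /card_leP/unsquash f := Tmin _ _ Uunc.
pose i (t : T) : T := set_val (f (SigSub (mem_set (I : [set: T] t)))).
have iU t : U (i t) by exact: set_valP.
have iinj : injective i.
  move=> s t /val_inj E.
  have := @inj _ _ _ f _ _ (mem_set I) (mem_set I) E.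
  by move=> /(congr1 val).
(* By minimality [T] embeds into the initial segment [U] of type omega1. *)
exists (fun a b => lt (i a) (i b)); split; last exact: Tunc.
- move=> a; have : Acc lt (i a) by exact: ltwf.
  move E : (i a) => u au; elim: au a E => {}u _ IH a E.
  by constructor=> b; rewrite E => bu; exact: IH bu b erefl.
- move=> a b; have [/iinj|?|?] := lttot (i a) (i b); first by constructor 1.
    by constructor 2.
  by constructor 3.
- by move=> a b c; exact: lttr.
- move=> b; apply: sub_countable (iU b).
  rewrite -(card_le_eql (inj_card_eq (in2W iinj))).
  by apply: subset_card_le => _ [a ab <-].
Qed.

(** * Recursion over the stages below omega1 *)

Lemma countable_dominated (I : Type) (S : set I) (f : I -> nat -> nat) :
  countable S -> exists g : nat -> nat, forall a, S a ->
    exists N, forall n, N <= n -> f a n <= g n.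
Proof.
move=> /countable_injP[c cinj].
have /choice[v Hv] : forall k, exists v, forall a, S a -> c a = k -> f a = v.
  move=> k; have [[a [Sa ak]]|nE] := pselect (exists a, S a /\ c a = k).
    exists (f a) => b Sb bk; congr f; apply: cinj; rewrite ?inE//.
    by rewrite ak.
  by exists (fun=> 0) => a Sa ak; case: nE; exists a.
exists (fun n => \sum_(k < n.+1) v k n) => a Sa; exists (c a) => n an.
have lt : c a < n.+1 by [].
by rewrite (bigD1 (Ordinal lt)) //= -(Hv (c a) a Sa erefl) leq_addr.
Qed.

Lemma coded_segment_wf (I : Type) (lt : I -> I -> Prop) (code : I -> nat)
    (u : I) :
  well_founded lt -> {in [set a | lt a u] &, injective code} ->
  well_founded (fun m n => exists a b,
    [/\ lt a u, lt b u, lt a b, code a = m & code b = n]).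
Proof.
move=> ltwf cinj m; constructor=> n [a [_ [au _ _ <- _]]].
elim/(well_founded_ind ltwf): a au => a IH au.
constructor=> k [b [c [bu cu bc <- ca]]]; apply: IH => //.
by rewrite -(cinj c a)// inE.
Qed.

Section CompactFamily.

Variables (I : Type) (lt : I -> I -> Prop) (code : I -> I -> nat).
Variable (g : I -> nat -> nat).

(* [t] codes an ordinal [u < d], and [m], [n] code ordinals below [u]: this is the
   order of [u] transported to [nat]. *)
Definition seg_rel (d : I) (t m n : nat) : Prop :=
  exists u, [/\ lt u d, code d u = t & exists a b,
    [/\ lt a u, lt b u, lt a b, code u a = m & code u b = n]].

(** An index that codes no stage below [d] yields the empty family. *)
Definition previous (d : I) (K : I -> set (nat -> nat)) (i : nat) :
    set (nat -> nat) :=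
  [set h | exists a, [/\ lt a d, code d a = i & K a h]].

(* A condition of level [k] lists, for each of the first [k] earlier families, a
   code of the ordinal bounding the ranks and the finite excess of the rank
   function over [g d]. *)
Definition conditions (n : nat) : seq (nat * nat) := odflt [::] (unpickle n).

Definition rank_condition (d : I) (K : I -> set (nat -> nat)) (n : nat) :
    set (nat -> nat) :=
  [set q | forall i a, i < size (conditions n) -> lt a d -> code d a = i ->
    ranked (K a) (seg_rel d (nth (0, 0) (conditions n) i).1)
      (fun e => g d e + (nth (0, 0) (conditions n) i).2) q].

Definition is_stage (d : I) (K : I -> set (nat -> nat)) :
    set (nat -> nat) -> Prop :=
  stage_family (g d) (previous d K) (rank_condition d K)
    (fun n => size (conditions n)).

Hypothesis lto : omega1_order lt.
Hypothesis code_inj :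
  forall d, {in [set a | lt a d] &, injective (code d)}.

Lemma seg_rel_wf (d : I) (t : nat) : well_founded (seg_rel d t).
Proof.
have [[u [ud ut]]|nu] := pselect (exists u, lt u d /\ code d u = t); last first.
  by move=> m; constructor=> n [u [ud ut _]]; case: nu; exists u.
move=> m; have := coded_segment_wf (omega1_wf lto) (@code_inj u) m.
move=> am; elim: am => {}m _ IH.
constructor=> n [u' [u'd u't ab]]; apply: IH.
by rewrite (_ : u = u')//; apply: (@code_inj d); rewrite ?inE ?ut.
Qed.

Lemma is_stage_exists (d : I) (K : I -> set (nat -> nat)) :
  (forall a, lt a d -> bounded_closed (K a)) -> exists X, is_stage d K X.
Proof.
move=> Kbc; apply: stage_family_exists.
- move=> i.
  have [[a [ad ai]]|na] := pselect (exists a, lt a d /\ code d a = i).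
    rewrite (_ : previous d K i = K a); first exact: Kbc.
    apply/seteqP; split=> [h [b [bd bi Kh]]|h Kh]; last by exists a.
    by rewrite (_ : a = b)//; apply: (@code_inj d); rewrite ?inE ?ai.
  split; first by exists (fun=> 0) => h [a [ad ai _]]; case: na; exists a.
  move=> h /(_ 0)[_ [a [ad ai _]] _].
  by case: na; exists a.
- move=> n q Hq i a ilt ad ai; apply: ranked_closed => m.
  by have [h Hh qh] := Hq m; exists h => //; exact: Hh.
- move=> n i q h Hq ilt [a [ad ai Kh]].
  by apply: ranked_not_meets (Hq i a ilt ad ai) Kh; exact: seg_rel_wf.
Qed.

Lemma staged_family_exists :
  exists K : I -> set (nat -> nat), forall d, is_stage d K (K d).
Proof.
have [K HK] := wf_recursion set0
  (fun d K => xget set0 [set X | is_stage d K X]) (omega1_wf lto).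
exists K => d; elim/(well_founded_ind (omega1_wf lto)): d => d IH.
(* Being a stage at [d] depends only on the families below [d], so the masked [K'] can replace
   [K]. *)
pose K' b := if `[< lt b d >] then K b else set0.
have K'K a : lt a d -> K' a = K a by move=> ad; rewrite /K' asboolT.
have prevE : previous d K = previous d K'.
  apply/funext => i; apply/seteqP.
  by split=> h [a [ad ai Kh]]; exists a; split=> //; move: Kh; rewrite K'K.
have condE : rank_condition d K = rank_condition d K'.
  apply/funext => n; apply/seteqP.
  by split=> q Hq i a ilt ad ai; move: (Hq i a ilt ad ai); rewrite K'K.
rewrite /is_stage prevE condE -/(is_stage d K' _) HK -/K'.
have [|X HX] := @is_stage_exists d K'.
  by move=> a ad; rewrite K'K//; exact: stage_bounded_closed (IH a ad).
exact: (xgetI set0 HX).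
Qed.

End CompactFamily.

(** * Catching every partial function at a closure point *)

Lemma omega1_compact_family (I : Type) (lt : I -> I -> Prop)
    (f : I -> nat -> nat) : omega1_order lt ->
  (forall h : nat -> nat, exists a N, forall n, N <= n -> h n <= f a n) ->
  exists K : I -> set (nat -> nat),
    [/\ forall a, bounded_closed (K a) /\ K a !=set0,
        forall a h h', K a h -> K a h' -> h <> h' ->
          eventually_different h h',
        forall a b h h', a <> b -> K a h -> K b h' ->
          eventually_different h h' &
        forall q, io (fun m => q m <> 0) ->
          exists a, exists2 h, K a h & meets q h].
Proof.
move=> lto fdom.
have /choice[code code_inj] : forall d, exists c : I -> nat,
    {in [set a | lt a d] &, injective c}.
  by move=> d; apply/countable_injP; exact: omega1_countable lto d.
have /choice[g Hg] : forall d, exists g : nat -> nat, forall a, lt a d ->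
    exists N, forall n, N <= n -> f a n <= g n.
  by move=> d; apply: countable_dominated; exact: omega1_countable lto d.
have [K HK] := staged_family_exists g lto code_inj.
exists K; split.
- move=> a; split; first exact: stage_bounded_closed (HK a).
  exact: stage_neq0 (HK a).
- by move=> a; exact: stage_ad (HK a).
- have lt_ed a b h h' : lt a b -> K b h -> K a h' -> eventually_different h h'.
    move=> ab Kh Kh'; apply: (stage_ad_prev (HK b) (i := code b a)) Kh _.
    by exists a.
  move=> a b h h' nab Kh Kh'; have [//|ab|ba] := omega1_total lto a b.
    by move=> ioE; apply: (lt_ed _ _ _ _ ab Kh' Kh); apply: sub_io ioE.
  exact: lt_ed ba Kh Kh'.
move=> q qio; apply: contrapT => nE.
have qad a h : K a h -> ~ meets q h.
  by move=> Kh qh; apply: nE; exists a, h.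
(* [u] bounds the ranks of [q] against [K a], [f w] dominates their codes, and [phi a] lies above
   both indices. *)
have /choice[phi Hphi] : forall a, exists v, exists u w (r : seq nat -> I),
    [/\ lt u v, lt w v, forall e, lt (r e) u,
        forall m e, hit_tree (K a) q (m :: e) -> lt (r (m :: e)) (r e) &
        exists N, forall n, N <= n ->
          code u (r (odflt [::] (unpickle n))) <= f w n].
  move=> a; have [r Hr] :=
    hit_rank_exists lto (stage_bounded_closed (HK a)) (qad a).
  have [u Hu] := omega1_bound_fun r lto (countableP [set: seq nat]).
  have [w Hw] := fdom (fun n => code u (r (odflt [::] (unpickle n)))).
  have [v Hv] := omega1_bound lto (finite_set_countable (finite_set2 u w)).
  exists v, u, w, r; split=> //.
  - by apply: Hv; left.
  - by apply: Hv; right.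
  - by move=> e; exact: Hu.
have /choice[next Hnext] : forall k, exists m, k <= m /\ q m <> 0.
  by move=> k; have [m] := qio k; exists m.
(* One function dominates both the values of [q] and the distance to its next domain point, as
   [stage_meets] requires. *)
have [w0 [N0 HN0]] := fdom (fun k => q k + next k).
have [d w0d dphi] := omega1_closure phi w0 lto.
have [N1 HN1] := Hg d _ w0d.
pose c := N0 + N1.
have bound k : c <= k -> q k <= g d k /\ next k <= g d k.
  move=> ck; have /HN0 : N0 <= k by rewrite /c in ck; lia.
  have /HN1 : N1 <= k by rewrite /c in ck; lia.
  by lia.
(* Deleting a finite part of the domain turns the eventual bound on values into a bound
   everywhere. *)
pose q' m := if m < c then 0 else q m.
have q'q m : q' m <> 0 -> q' m = q m by rewrite /q'; case: ifP.
have [||k|h Kh q'h] := stage_meets (HK d) (q := q').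
- by move=> m; rewrite /q'; case: ltnP => // /bound[].
- exists c => k ck; exists (next k).
    by rewrite (Hnext k).1 (bound k ck).2.
  rewrite /q' ltnNge (leq_trans ck (Hnext k).1) /=.
  exact: (Hnext k).2.
- have /choice[s Hs] : forall i, exists p : nat * nat, forall a,
      lt a d -> code d a = i ->
      ranked (K a) (seg_rel lt code d p.1) (fun e => g d e + p.2) q'.
    move=> i.
    have [[a [ad ai]]|na] := pselect (exists a, lt a d /\ code d a = i);
      last by exists (0, 0) => a ad ai; case: na; exists a.
    have [u [w [r [uv wv ru rlt [N HN]]]]] := Hphi a.
    have ud := omega1_trans lto uv (dphi a ad).
    have [N' HN'] := Hg d w (omega1_trans lto wv (dphi a ad)).
    pose rho n := code u (r (odflt [::] (unpickle n))).
    (* The sum absorbs the finitely many places where the rank codes may exceed [g d]. *)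
    exists (code d u, \sum_(n < N + N') rho n) => b bd bi.
    have -> : b = a by apply: (code_inj d); rewrite ?inE ?ai.
    apply: (ranked_sub q'q); exists rho => [n /=|m e me /=].
      have [nN|nN] := ltnP n (N + N').
        apply: leq_trans (leq_addl _ _).
        by rewrite (bigD1 (Ordinal nN)) //= leq_addr.
      apply: leq_trans (leq_addr _ _).
      by apply: leq_trans (HN _ _) (HN' _ _); lia.
    rewrite /rho !pickleK /=; exists u; split=> //.
    by exists (r (m :: e)), (r e); split=> //; exact: rlt.
  have condE : conditions (pickle (mkseq s k)) = mkseq s k.
    by rewrite /conditions pickleK.
  exists (pickle (mkseq s k)) => [|i a]; rewrite condE size_mkseq// => ik.
  by rewrite nth_mkseq//; exact: Hs.
apply: (qad d h Kh); apply: sub_io q'h => m q'm.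
by rewrite -q'm q'q// q'm.
Qed.

(** * Transfer to Baire space *)

Lemma has_card_aleph1_eq (T U : Type) (A : set T) (B : set U) :
  (A #= B)%card -> has_card_aleph1 A -> has_card_aleph1 B.
Proof.
move=> AB [Aunc Amin]; split; first by rewrite -(eq_countable AB).
by move=> V C /Amin; rewrite (card_le_eql AB).
Qed.

Theorem theorem1 (hd : d_eq_aleph1) :
  exists C : set (set baire),
    [/\ has_card_aleph1 C,
        forall K : set baire, C K -> compact K
      & van_douwen_mad_family (\bigcup_(K in C) K)].
Proof.
have [A [[D Ddom AD] _] Aal] := hd.
have Dal : has_card_aleph1 [set: D].
  apply: has_card_aleph1_eq Aal.
  exact: card_eq_trans AD (card_setT_sym D).
have [lt lto] := omega1_order_exists Dal.
have fdom (h : nat -> nat) :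
    exists (a : D) N, forall n, N <= n -> h n <= (set_val a : baire) n.
  have [f Df [N hf]] := Ddom h.
  by exists (SigSub (mem_set Df)), N.
have [K [Kbc Kad Kad' Kmeets]] := omega1_compact_family lto fdom.
(* A common member of two distinct stages would be eventually different from itself; injectivity
   gives exactly aleph1 compact sets. *)
have Kinj : injective K.
  move=> a b Kab; apply: contrapT => nab.
  have [h Kh] := (Kbc a).2.
  have /(_ a b h h nab Kh) := Kad'; rewrite -Kab => /(_ Kh); apply.
  by move=> N; exists N.
have ad : ad_family (\bigcup_(X in range K) X).
  move=> h h' [_ [a _ <-] Kh] [_ [b _ <-] Kh'] hh'.
  apply: contrapT => /infinite_setP.
  have [ab|nab] := pselect (a = b); last exact: Kad' nab Kh Kh'.
  by apply: (Kad a) => //; rewrite ab.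
have vd : van_douwen (\bigcup_(X in range K) X).
  split=> // B p Binf.
  pose q m := if `[< B m >] then (p m).+1 else 0.
  have [|a [h Kh qh]] := Kmeets q.
    apply: sub_io ((infinite_setP B).1 Binf) => m Bm.
    by rewrite /q asboolT.
  exists h; first by exists (K a) => //; exists a.
  pose S := [set m | B m /\ h m = p m].
  have -> : graph h `&` pgraph B p = (fun m => (m, h m)) @` S.
    apply/seteqP; split=> [[m v] [[_ /= ->] [/= Bm hp]]|_ [m [Bm hp] <-]].
      by exists m.
    by split.
  apply: card_eq_trans (inj_card_eq _) _; first by move=> m n _ _ [].
  apply: eq_card_nat => //; apply/infinite_setP.
  apply: sub_io qh => m; rewrite /q /S /=.
  by case: asboolP => // Bm [->].
exists (range K); split.
- apply: has_card_aleph1_eq Dal; rewrite card_eq_sym.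
  by apply: inj_card_eq; exact: in2W.
- by move=> _ [a _ <-]; apply: bounded_closed_compact; exact: (Kbc a).1.
- split=> //; split=> // f.
  (* Maximality among total functions is the Van Douwen property for the full domain. *)
  have [h Fh fh] := vd.2 [set: nat] f infinite_nat.
  by exists h => //; rewrite setIC.
Qed.
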